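(* Let $u,v\geq 3$ be integers and let $M=\begin{bmatrix} a & b\\ c & d\end{bmatrix}\in\mathscr{G}_{u,v}$. Then $M\in G_{u,v}$ if and only if $(f\circ C)(b/d)$ satisfies the $(u,v)$-divisibility property.
   Context: For positive integers $u,v$ let $L_u=\begin{bmatrix}1 & 0\\ u & 1\end{bmatrix}$ and $R_v=\begin{bmatrix}1 & v\\ 0 & 1\end{bmatrix}$. $G_{u,v}$ is the subgroup of $SL_2(\mathbb{Z})$ generated by $L_u$ and $R_v$, and $$\mathscr{G}_{u,v}=\left\{\begin{bmatrix}1+uvn_1 & vn_2\\ un_3 & 1+uvn_4\end{bmatrix}\in SL_2(\mathbb{Z}) : (n_1,n_2,n_3,n_4)\in\mathbb{Z}^4\right\}.$$ For integers $q_0,\dots,q_r$, $[q_0,q_1,\dots,q_r]$ denotes the (possibly undefined) continued fraction $q_0+\cfrac{1}{q_1+\cfrac{1}{\ddots+\cfrac{1}{q_r}}}$. Let $A=\bigcup_{r\geq 0}(\mathbb{Z}\times\mathbb{Z}_{\neq 0}^r)$, with elements written $\llbracket q_0,\dots,q_r\rrbracket$. Let $A_0=\{\llbracket q_0,\dots,q_r\rrbracket\in A : [q_i,\dots,q_r]\neq 0\text{ when }0<i<r\}$, $A_1=\{\llbracket q_0,\dots,q_r\rrbracket\in A_0 : q_i\geq 1\text{ when }0<i<r,\text{ and }q_r>1\text{ when }r>0\}$, $A_2=\{\llbracket q_0,\dots,q_r\rrbracket\in A_0 : |q_i|>1\text{ when }0<i\leq r\}$. Every rational $x$ has a unique representation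 $x=[x_0,\dots,x_r]$ with $\llbracket x_0,\dots,x_r\rrbracket\in A_1$ (the short continued fraction representation); $C:\mathbb{Q}\to A_1$ is defined by $C(x)=\llbracket x_0,\dots,x_r\rrbracket$. Set $-\llbracket q_0,\dots,q_r\rrbracket:=\llbracket -q_0,\dots,-q_r\rrbracket$. Define $\llbracket q_0,\dots,q_m\rrbracket\oplus\llbracket p_0,\dots,p_n\rrbracket$ to be $\llbracket q_0,\dots,q_m,p_0,\dots,p_n\rrbracket$ if $p_0\neq 0$, and $\llbracket q_0,\dots,q_{m-1},q_m+p_1,p_2,\dots,p_n\rrbracket$ if $p_0=0$ (only used with $n\geq 1$). Define $f:A_1\to A_2$ recursively: $f(\llbracket q_0,\dots,q_r\rrbracket)=\llbracket q_0,\dots,q_r\rrbracket$ if $r=0$ or $q_i\neq 1$ for all $0<i<r$; otherwise, with $j$ the smallest index with $0<j<r$ and $q_j=1$, $$f(\llbracket q_0,\dots,q_r\rrbracket)=\llbracket q_0,\dots,q_{j-2},q_{j-1}+1\rrbracket\oplus -f(\llbracket q_{j+1}+1,q_{j+2},\dots,q_r\rrbracket).$$ A sequence $\llbracket q_0,\dots,q_r\rrbracket\in A$ satisfies the $(u,v)$-divisibility property if $v\mid q_i$ for every even index $i$ and $u\mid q_i$ for every odd index $i$. *)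

(* Defs.v *)
From mathcomp Require Import all_boot all_order all_algebra.
From mathcomp Require Import zify ring lra.

Set Implicit Arguments.
Unset Strict Implicit.
Unset Printing Implicit Defensive.

Import Order.TTheory GRing.Theory Num.Theory.
Local Open Scope ring_scope.

Definition mx2 (a b c d : int) : 'M[int]_2 :=
  \matrix_(i, j) (if i == 0 then (if j == 0 then a else b)
                  else (if j == 0 then c else d)).

Definition Lmx (u : int) : 'M[int]_2 := mx2 1 0 u 1.
Definition Rmx (v : int) : 'M[int]_2 := mx2 1 v 0 1.

(* Both generators have determinant 1, so the ring inverse below is the genuine
   inverse and the generated group lies in SL_2(Z). *)
Inductive in_G (u v : int) : 'M[int]_2 -> Prop :=
| in_G_L : in_G u v (Lmx u)
| in_G_R : in_G u v (Rmx v)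
| in_G_1 : in_G u v 1
| in_G_mul M N : in_G u v M -> in_G u v N -> in_G u v (M * N)
| in_G_inv M : in_G u v M -> in_G u v M^-1.

Definition in_scrG (u v : int) (M : 'M[int]_2) : Prop :=
  \det M = 1 /\
  exists n1 n2 n3 n4 : int,
    M = mx2 (1 + u * v * n1) (v * n2) (u * n3) (1 + u * v * n4).

(* Value of the continued fraction [q_0, ..., q_r]; None means undefined. *)
Fixpoint cf (s : seq int) : option rat :=
  match s with
  | [::] => None
  | [:: q] => Some q%:~R
  | q :: s' =>
      if cf s' is Some y then
        if y == 0 then None else Some (q%:~R + y^-1)
      else None
  end.

(* A sequence q_0, ..., q_r is a list s with r = (size s).-1; the indices i
   with 0 < i < r are those in iota 1 (size s).-2. *)
Definition inA (s : seq int) : bool :=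
  (s != [::]) && all (fun q => q != 0) (behead s).

Definition inA0 (s : seq int) : bool :=
  inA s && all (fun i => cf (drop i s) != Some 0) (iota 1 (size s).-2).

Definition inA1 (s : seq int) : bool :=
  [&& inA0 s, all (fun i => 1 <= s`_i) (iota 1 (size s).-2)
    & (1 < size s)%N ==> (1 < last 0 s)].

Definition inA2 (s : seq int) : bool :=
  inA0 s && all (fun q => 1 < `|q|) (behead s).

Fixpoint scf_rec (s : seq int) : bool :=
  match s with
  | [::] => false
  | [:: _] => true
  | _ :: ((p :: s'') as s') => [&& 1 <= p, (s'' == [::]) ==> (1 < p) & scf_rec s']
  end.

Lemma scf_rec_cf q s : scf_rec (q :: s) ->
  exists y : rat, [/\ cf (q :: s) = Some y, q%:~R <= y, y < (q + 1)%:~R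
                    & s != [::] -> q%:~R < y].
Proof.
elim: s q => [|p s IH] q.
  by move=> _; exists q%:~R; split=> //; rewrite ltr_int; lia.
have -> : scf_rec [:: q, p & s] =
    [&& 1 <= p, (s == [::]) ==> (1 < p) & scf_rec (p :: s)] by [].
move=> /and3P[p1 ps /IH[y [E ley _ lty]]].
have y1 : 1 < y.
  have p1' : (1 : rat) <= p%:~R by rewrite (ler_int _ 1).
  case: s ps lty {IH E} => [|r s] /= ps lty.
    by apply: (@lt_le_trans _ _ p%:~R); rewrite // (ltr_int _ 1).
  exact: le_lt_trans p1' (lty isT).
have y0 : 0 < y by lra.
have yV0 : 0 < y^-1 by rewrite invr_gt0.
have yV1 : y^-1 < 1 by rewrite invf_lt1.
exists (q%:~R + y^-1); rewrite [cf _]/= -/(cf (p :: s)) E gt_eqF //.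
by rewrite intrD; split=> //; lra.
Qed.

Lemma inA1E s : inA1 s = scf_rec s.
Proof.
elim: s => [|q [|p s] IH] //.
have shift (P : pred nat) n : all P (iota 2 n) = all (P \o S) (iota 1 n).
  by rewrite (iotaDl 1 1) all_map.
case: s IH => [|r s] IH.
  by rewrite /inA1 /inA0 /inA /=; lia.
rewrite [RHS]/= -/(scf_rec (p :: r :: s)) -IH.
have nz : 1 <= p -> inA1 (p :: r :: s) -> cf (p :: r :: s) != Some 0.
  move=> p1; rewrite IH => /scf_rec_cf[y [-> ley _ _]].
  apply/eqP => -[y0]; move: ley; rewrite y0 (ler_int _ _ 0); lia.
have E : inA1 (q :: p :: r :: s) =
    [&& p != 0, 1 <= p, cf (p :: r :: s) != Some 0 & inA1 (p :: r :: s)].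
  rewrite /inA1 /inA0 /inA [size _]/= [size (p :: _)]/=.
  rewrite /= !shift.
  have AC (a b d e g h k l : bool) : [&& [&& [&& a, b & d], e & g], h && k & l]
      = [&& a, h, e, (b && d) && g, k & l].
    by case: a b d e g h k l => [] [] [] [] [] [] [] [].
  exact: AC.
rewrite E; case p1 : (1 <= p); last by rewrite andbF.
have -> : p != 0 by lia.
rewrite !andTb.
by apply/andP/idP => [[]//|h]; split=> //; apply: nz.
Qed.

Lemma inA1_exists (x : rat) : exists s, inA1 s && (cf s == Some x).
Proof.
suff H (n : nat) (a b : int) : 0 < b -> (`|b| <= n)%N ->
    exists s, inA1 s && (cf s == Some (a%:~R / b%:~R)).
  by have := H _ (numq x) (denq x) (denq_gt0 x) (leqnn _); rewrite divq_num_den.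
elim: n a b => [|n IH] a b b0 bn; first by lia.
have b0Q : (b%:~R : rat) != 0 by rewrite intr_eq0; lia.
have Ea := divz_eq a b.
have r0 := modz_ge0 a (lt0r_neq0 b0); have rb := ltz_pmod a b0.
move: (a %/ b)%Z (a %% b)%Z Ea r0 rb => q r Ea r0 rb.
have [r1|r1] := eqVneq r 0.
  exists [:: q]; rewrite /= Ea r1 addr0 intrM mulfK //.
have r0Q : (r%:~R : rat) != 0 by rewrite intr_eq0.
have [||[|p s] /andP[A1s /eqP Es]] := IH b r; [by lia | by lia | by [] |].
have y1 : 1 < (b%:~R / r%:~R : rat).
  by rewrite ltr_pdivlMr ?mul1r ?ltr_int ?ltr0z //; lia.
exists (q :: p :: s); apply/andP; split; last first.
  rewrite [cf _]/= -/(cf (p :: s)) Es gt_eqF; last by lra.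
  by rewrite Ea intrD intrM invf_div mulrDl mulfK.
move: (A1s); rewrite !inA1E => A1s'.
have [y [Ey _ ltp eqp]] := scf_rec_cf A1s'.
move: Ey; rewrite Es => -[Ey]; subst y.
have p1 : 1 <= p by have := lt_trans y1 ltp; rewrite (ltr_int _ 1); lia.
rewrite /= p1 /=; apply/andP; split=> //; apply/implyP => /eqP s0.
by move: Es y1; rewrite s0 => -[<-]; rewrite (ltr_int _ 1).
Qed.

Lemma inA1_unique s t : inA1 s -> inA1 t -> cf s = cf t -> s = t.
Proof.
rewrite !inA1E; elim: s t => [|q s IH] [|p t] // hs ht.
have [y [Ey y1 y2 y3]] := scf_rec_cf hs.
have [z [Ez z1 z2 z3]] := scf_rec_cf ht.
move=> E; have Eyz : y = z by move: E; rewrite Ey Ez => -[].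
subst z; have Eqp : q = p.
  have := le_lt_trans y1 z2; have := le_lt_trans z1 y2; rewrite !ltr_int; lia.
subst p; congr (_ :: _).
have C0 w : cf [:: q] = cf w -> cf w = Some q%:~R by move=> <-.
case: s t IH hs ht Ey Ez y3 z3 E => [|p s] [|r t] IH hs ht Ey Ez y3 z3 E //.
- by have := z3 isT; case: Ey => ->; rewrite ltxx.
- by have := y3 isT; case: Ez => ->; rewrite ltxx.
have hs' : scf_rec (p :: s) by case/and3P: (hs : [&& _, _ & _]).
have ht' : scf_rec (r :: t) by case/and3P: (ht : [&& _, _ & _]).
apply: IH => //.
have [a [Ea _ _ _]] := scf_rec_cf hs'; have [b [Eb _ _ _]] := scf_rec_cf ht'.
move: E; rewrite [LHS]/= [X in _ = X]/= -/(cf (p :: s)) -/(cf (r :: t)) Ea Eb.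
case: ifP Ey => [a0|a0]; first by rewrite [cf _]/= -/(cf (p :: s)) Ea a0.
case: ifP Ez => [b0|b0]; first by rewrite [cf _]/= -/(cf (r :: t)) Eb b0.
by move=> _ _ [] /addrI /invr_inj ->.
Qed.

(* The short continued fraction representation of x: by the two previous lemmas
   it is the one element of A_1 whose value is x. *)
Definition C (x : rat) : seq int := xchoose (inA1_exists x).

Lemma CP x : inA1 (C x) /\ cf (C x) = Some x.
Proof. by have /andP[? /eqP] := xchooseP (inA1_exists x). Qed.

Definition oppA (s : seq int) : seq int := map -%R s.

(* When p_0 = 0 the second argument is meant to have at least two terms; the
   other degenerate cases get dummy values. *)
Definition oplus (q p : seq int) : seq int :=
  match p with
  | [::] => q
  | p0 :: p' =>
      if p0 != 0 then q ++ p
      else match p' with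
           | [::] => q
           | p1 :: p'' => take (size q).-1 q ++ (last 0 q + p1) :: p''
           end
  end.

(* In f_rec, j is the least positive index with q_j = 1, if there is one, and
   j > r otherwise. The argument n bounds the recursion depth; the lemma fE is
   the recursive definition of f. *)
Fixpoint f_rec (n : nat) (q : seq int) : seq int :=
  let r := (size q).-1 in
  let j := (index 1 (behead q)).+1 in
  if n is n'.+1 then
    if (j < r)%N then
      oplus (rcons (take j.-1 q) (q`_j.-1 + 1))
            (oppA (f_rec n' ((q`_j.+1 + 1) :: drop j.+2 q)))
    else q
  else q.

Definition f (q : seq int) : seq int := f_rec (size q) q.

Lemma fE (q : seq int) :
  let r := (size q).-1 in
  let j := (index 1 (behead q)).+1 in
  f q = if (j < r)%N then
          oplus (rcons (take j.-1 q) (q`_j.-1 + 1))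
                (oppA (f ((q`_j.+1 + 1) :: drop j.+2 q)))
        else q.
Proof.
have irr n s : (size s <= n)%N -> f_rec n s = f_rec (size s) s.
  elim/ltn_ind: n s => n IH s.
  case: n IH => [|n] IH; first by rewrite leqn0 => /eqP/size0nil ->.
  case: s => [|a s] /= sn; first by [].
  case: ifP => // jr; congr (oplus _ (oppA _)).
  by rewrite IH //=; [rewrite [RHS]IH //= |]; rewrite ?size_drop; lia.
rewrite /= /f; case: q => [|a s] //=.
case: ifP => // jr; congr (oplus _ (oppA _)).
by rewrite irr //= size_drop; lia.
Qed.

Lemma cf_gt1 q s : all (fun q => 1 < `|q|) (q :: s) ->
  exists2 y, cf (q :: s) = Some y & 1 < `|y|.
Proof.
elim: s q => [|p s IH] q /=.
  move=> h; exists q%:~R => //; rewrite -intr_norm (ltr_int _ 1); lia.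
move=> /andP[q1 /IH[y Ey y1]]; exists (q%:~R + y^-1).
  by rewrite -/(cf (p :: s)) Ey; case: eqP y1 => // ->; rewrite normr0 ltr10.
have q2 : 2 <= `|q%:~R : rat| by rewrite -intr_norm (ler_int _ 2); lia.
have yV : `|y^-1| < 1 by rewrite normfV invf_lt1 // (lt_trans _ y1).
by have := lerB_normD q%:~R y^-1; lra.
Qed.

Lemma inA2I q s : all (fun q => 1 < `|q|) s -> inA2 (q :: s).
Proof.
move=> hs; rewrite /inA2 /inA0 /inA /= hs andbT; apply/andP; split.
  by apply: sub_all hs => p; lia.
apply/allP => -[|i]; rewrite mem_iota // => ir /=.
case E : (drop i s) => [|p t] //.
have : all (fun q => 1 < `|q|) (drop i s).
  by apply/allP => z /mem_drop; move: z; apply/allP.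
rewrite E => /cf_gt1[y -> y1]; apply/eqP => -[y0].
by rewrite y0 normr0 ltr10 in y1.
Qed.

Lemma scf_recE q t :
  scf_rec (q :: t) = all (fun q => 1 <= q) t && (1 < last 2 t).
Proof.
elim: t q => [|p t IH] q //.
have -> : scf_rec [:: q, p & t] =
  [&& 1 <= p, (t == [::]) ==> (1 < p) & scf_rec (p :: t)] by [].
rewrite IH /= -andbA; case: t {IH} => [|r t] //=; lia.
Qed.

Lemma f_inA2 s : inA1 s -> inA2 (f s).
Proof.
suff H n q t : (size t < n)%N -> scf_rec (q :: t) ->
    exists p t', [/\ f (q :: t) = p :: t', q <= p & all (fun q => 1 < `|q|) t'].
  rewrite inA1E; case: s => [|q t] // /(H _ _ _ (ltnSn _))[p [t' [-> _ ?]]].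
  exact: inA2I.
elim: n q t => [|n IH] q t //; rewrite ltnS scf_recE => tn /andP[t1 tl].
have gt1 k : (k <= index (1 : int) t)%N -> all (fun q => 1 < `|q|) (take k t).
  move=> kt; apply/(all_nthP 0) => i; rewrite size_take_min ltn_min => /andP[ik it].
  rewrite nth_take //; have := before_find 0 (leq_trans ik kt).
  have /= := all_nthP 0 t1 i it; move: t`_i => z h /negbT/eqP; lia.
rewrite fE /=; case: ifP => [jr|/negbT]; last first.
  rewrite -leqNgt => jr; exists q, t; split=> //.
  case: (lastP t) t1 tl gt1 jr => [|t' z] // t1.
  rewrite last_rcons size_rcons ltnS => z1 gt1 jr.
  rewrite all_rcons; apply/andP; split; first by lia.
  by have := gt1 (size t') jr; rewrite -cats1 take_size_cat.
move: (index _ t) jr gt1 => j jr gt1.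
have [||p [t' [-> p1 t'1]]] := IH (t`_j.+1 + 1) (drop j.+2 t).
- by rewrite size_drop; lia.
- rewrite scf_recE; apply/andP; split.
    by apply/allP => z /mem_drop; move: z; apply/allP.
  have [js|js] := ltnP j.+2 (size t); last by rewrite drop_oversize.
  by move: tl; rewrite -{1}(cat_take_drop j.+2 t) last_cat (drop_nth 0).
have tj : 1 <= t`_j.+1 by apply: (all_nthP 0 t1).
have p0 : - p != 0 by move: t`_j.+1 p1 tj => z p1 tj; lia.
have mp : all (fun q => 1 < `|q|) (- p :: oppA t').
  rewrite /= all_map; apply/andP; split; first by lia.
  by apply: sub_all t'1 => z /=; rewrite normrN.
rewrite /= p0; case Ej : j => [|k] /=.
  by exists (q + 1), (- p :: oppA t'); split=> //; lia.
exists q, (rcons (take k t) (t`_k + 1) ++ (- p :: oppA t')); split=> //.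
rewrite all_cat mp all_rcons gt1 ?Ej // !andbT.
have tk : 1 <= t`_k by apply: (all_nthP 0 t1); rewrite Ej in jr; apply: ltn_trans jr.
by move: t`_k tk => z tk; lia.
Qed.

Definition divisibility_property (u v : int) (q : seq int) : Prop :=
  forall i : nat, (i < size q)%N -> ((if odd i then u else v) %| q`_i)%Z.

(* Main.v *)
Require Import Defs.
From mathcomp Require Import all_boot all_order all_algebra.
From mathcomp Require Import zify ring lra.
Import Order.TTheory GRing.Theory Num.Theory.
Local Open Scope ring_scope.

(** Continued fractions are read off the second column [b; d] of a matrix.
Left multiplication by R_q sends the ratio x = b/d to q + x, and by L_q it
sends 1/x to q + 1/x; so, starting from the identity (ratio 0), the product
R_(q_0) L_(q_1) R_(q_2) ... R_(q_r) with r even has ratio [q_0, ..., q_r].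

The function f o C is the nearest-integer continued fraction algorithm: each
step writes x = n + 1/y with |y| >= 2, and recurses on y up to sign
([f_nearest_step]). Hence f o C preserves the value ([cf_f]). It also finds
every expansion q_0, ..., q_r with |q_i| >= 3 for i > 0 ([f_of_large_cf]): the
tail of such an expansion has absolute value > 2, so q_0 is the only integer
within distance 1/2 of the value, and the argument repeats on the tail.

If M lies in G, write it as a word in the generators. Since u, v >= 3, merging
adjacent powers of the same generator yields an expansion of b/d whose terms
are alternately divisible by v and u and, after the first, nonzero, hence of
absolute value >= 3 ([in_G_reduced_ratio]). That expansion must be f (C (b/d)).

Conversely, if f (C (b/d)) has the divisibility property, multiply M on the
left by R_(-q_0), L_(-q_1), ... in turn, which are elements of G. This runs
the expansion backwards until the second column is (0, d), which the
determinant and the congruence d = 1 mod u turn into (0, 1); what is left is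
L_c with u | c ([in_G_of_cf]). The congruence also excludes expansions of even
length, which would end with a column (b, 0). *)

(* Otherwise simplification unfolds the fuel-bounded recursion behind f, and
   the equation fE no longer applies. *)
Local Arguments f : simpl never.

(** * The function f as a nearest-integer algorithm *)

Lemma oplus_cons (q : int) s t : s != [::] -> oplus (q :: s) t = q :: oplus s t.
Proof. by case: s => [|p s] //; case: t => [|t0 [|t1 t]] //=; case: ifP. Qed.

Lemma f_cons (q p : int) s : (p != 1) || (s == [::]) -> f [:: q, p & s] = q :: f (p :: s).
Proof.
case: s => [|r s] //.
rewrite orbF => /negbTE p1; rewrite [LHS]fE [in RHS]fE /= p1 ltnS.
by case: ifP => // _; rewrite -oplus_cons // -size_eq0 size_rcons.
Qed.

Lemma scf_rec_behead (q p : int) s : scf_rec [:: q, p & s] -> scf_rec (p :: s).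
Proof. by case/and3P. Qed.

Lemma scf_rec_head (q r : int) s : scf_rec (q :: s) = scf_rec (r :: s).
Proof. by rewrite !scf_recE. Qed.

Lemma scf_rec_cons1 (q r : int) s : scf_rec [:: q, 1, r & s] ->
  1 <= r /\ scf_rec (r + 1 :: s).
Proof.
move=> /scf_rec_behead h; split; first by case/and3P: h.
by rewrite (scf_rec_head _ r); apply: scf_rec_behead h.
Qed.

(** The terms of an element of A_1 after the first are positive, so the bound on
the head ensures that the p_0 = 0 case of oplus never occurs in f. *)
Lemma f_head (q : int) s : scf_rec (q :: s) -> exists p t, f (q :: s) = p :: t /\ q <= p.
Proof.
have [n] := ubnP (size s); elim: n q s => // n IH q [|p s] sn hs.
  by exists q, [::].
have [/f_cons -> | ] := boolP ((p != 1) || (s == [::])); first by exists q; eexists.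
rewrite negb_or negbK => /andP[/eqP p1]; subst p.
case: s sn hs => // r s sn /scf_rec_cons1[r1 hr] _.
have [|p [t [E pr]]] := IH (r + 1) s _ hr; first by move: sn => /=; lia.
rewrite fE /= drop0 E /=.
have -> : - p != 0 by lia.
by exists (q + 1); eexists; split => //; lia.
Qed.

Lemma f_cons_one (q r : int) s : scf_rec [:: q, 1, r & s] ->
  f [:: q, 1, r & s] = q + 1 :: oppA (f (r + 1 :: s)).
Proof.
move=> /scf_rec_cons1[r1 hr]; have [p [t [E pr]]] := f_head _ _ hr.
rewrite fE /= drop0 E /=.
by have -> : - p != 0 by lia.
Qed.

Lemma cf_cons (q p : int) s : cf [:: q, p & s] =
  if cf (p :: s) is Some y then
    if y == 0 then None else Some (q%:~R + y^-1) else None.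
Proof. by []. Qed.

Lemma cf_oppA s : cf (oppA s) = omap -%R (cf s).
Proof.
elim: s => [|q [|p s] IH] //; first by rewrite /= rmorphN.
rewrite cf_cons [oppA _]/= cf_cons; move: IH; rewrite [oppA _]/= => ->.
case: (cf _) => //= y; rewrite oppr_eq0; case: ifP => //= _.
by rewrite invrN rmorphN opprD.
Qed.

Lemma oppAK : involutive oppA.
Proof. by move=> s; rewrite /oppA -map_comp map_id_in // => x _ /=; rewrite opprK. Qed.

Lemma cf_head (q r : int) s y :
  cf (q :: s) = Some y -> cf (r :: s) = Some (y + (r - q)%:~R).
Proof.
case: s => [|p s]; first by move=> /= -[<-]; rewrite rmorphB /= addrC subrK.
rewrite !cf_cons; case: (cf _) => // z; case: ifP => // _ [<-]; congr Some.
by rewrite rmorphB /=; ring.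
Qed.

(** The sign produced by one step of f, as a boolean so that it matches the
scalar [(-1) ^+ e] acting on the value. *)
Definition signA (e : bool) (s : seq int) := if e then oppA s else s.

Lemma signAK e : involutive (signA e).
Proof. by case: e => //; apply: oppAK. Qed.

Lemma cf_signA e s : cf (signA e s) = omap ( *%R ((-1) ^+ e)) (cf s).
Proof.
case: e => /=; last by case: (cf s) => //= y; rewrite mul1r.
by rewrite cf_oppA; case: (cf s) => //= y; rewrite mulN1r.
Qed.

(** One step of the nearest-integer algorithm. When the second term is at least
2, the fractional part is at most 1/2 and n = q. When it is 1, with tail z,
the identity q + 1 / (1 + 1 / z) = q + 1 - 1 / (z + 1) rounds up to n = q + 1
and flips the sign. *)
Lemma f_nearest_step (q p : int) s : scf_rec [:: q, p & s] ->
  exists n e s' y, [/\ scf_rec s' /\ (size s' <= (size s).+1)%N,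
    f [:: q, p & s] = n :: signA e (f s'), cf s' = Some y, 2 <= y
    & cf [:: q, p & s] = Some (n%:~R + ((-1) ^+ e * y)^-1)].
Proof.
move=> hs; have hp := scf_rec_behead _ _ _ hs.
have [y [Ey y1 y2 _]] := scf_rec_cf hp.
have [pn1|] := boolP ((p != 1) || (s == [::])).
  have p2 : 2 <= p by case/and3P: hs => ? /implyP hs _; case/orP: pn1 => [|/hs]; lia.
  have y2' : 2 <= y by apply: le_trans y1; rewrite (ler_int _ 2).
  exists q, false, (p :: s), y; split; rewrite ?f_cons ?mul1r //.
  by rewrite cf_cons Ey gt_eqF //; lra.
rewrite negb_or negbK => /andP[/eqP p1]; subst p.
case: s hs hp Ey => // r s hs hp Ey _.
have [r1 hr] := scf_rec_cons1 _ _ _ hs.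
have [z [Ez z1 _ _]] := scf_rec_cf (scf_rec_behead _ _ _ hp).
have z1' : 1 <= z by apply: le_trans z1; rewrite (ler_int _ 1).
have z0 : z != 0 by rewrite gt_eqF //; lra.
have z10 : z + 1 != 0 by rewrite gt_eqF //; lra.
exists (q + 1), true, (r + 1 :: s), (z + 1); split => //.
- exact: f_cons_one.
- by rewrite (cf_head r _ _ z Ez) [r + 1]addrC addrK.
- by lra.
rewrite !cf_cons Ez (negbTE z0).
have Ew : 1%:~R + z^-1 = (z + 1) / z :> rat by field.
rewrite Ew mulf_eq0 invr_eq0 (negbTE z0) (negbTE z10) /=; congr Some.
rewrite rmorphD /=; field; apply/andP; split => //; rewrite gt_eqF //; lra.
Qed.

Lemma f_neq0 s : scf_rec s -> f s != [::].
Proof. by case: s => // q s /f_head[p [t [->]]]. Qed.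

Lemma cf_f s : scf_rec s -> cf (f s) = cf s.
Proof.
have [n] := ubnP (size s); elim: n s => // n IH [|q [|p s]] // sn.
move=> /f_nearest_step[m [e [s' [y [[hs' s'n] -> Ey y2 ->]]]]].
have E : cf (signA e (f s')) = Some ((-1) ^+ e * y).
  by rewrite cf_signA IH ?Ey //; move: sn s'n => /=; lia.
have : signA e (f s') != [::].
  by have := f_neq0 _ hs'; case: (e) (f s') => [] [].
case Et: (signA e (f s')) => [|t0 t] // _; rewrite cf_cons -Et E.
by rewrite mulf_eq0 signr_eq0 /= gt_eqF //; lra.
Qed.

(** The strict bound is for an expansion with large terms, the other one for f,
which may meet an exact tie. *)
Lemma nearest_unique (m n : int) (x y : rat) :
  m%:~R + x = n%:~R + y -> `|x| < 2^-1 -> `|y| <= 2^-1 -> m = n /\ x = y.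
Proof.
move=> E hx hy; suff mn : m = n by subst n; split => //; lra.
have h : `|(m - n)%:~R : rat| < 1%:~R.
  rewrite rmorphB /= (_ : _ - _ = y - x); last by lra.
  by apply: le_lt_trans (ler_normB _ _) _; lra.
by move: h; rewrite -intr_norm ltr_int; lia.
Qed.

(** Terms of absolute value at least 3 lose less than 1 to the reciprocal of
their tail, which by [cf_gt1] has absolute value above 1. *)
Lemma cf_gt2 (q : int) s : all (fun q : int => 2 < `|q|) (q :: s) ->
  exists2 y, cf (q :: s) = Some y & 2 < `|y|.
Proof.
have sub t : all (fun q : int => 2 < `|q|) t -> all (fun q : int => 1 < `|q|) t.
  by apply: sub_all => z; lia.
move=> /[dup] h /= /andP[q2 hs].
have q3 : 3 <= `|q%:~R : rat| by rewrite -intr_norm (ler_int _ 3); lia.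
case: s hs {h} => [|p s] hs; first by exists q%:~R => //; lra.
have [y Ey y1] := cf_gt1 (sub _ hs); rewrite Ey.
have y0 : y != 0 by rewrite -normr_gt0; lra.
exists (q%:~R + y^-1); first by rewrite (negbTE y0).
have yV : `|y^-1| < 1 by rewrite normfV invf_lt1 // (lt_trans _ y1).
by have := lerB_normD q%:~R y^-1; lra.
Qed.

Lemma normV_lt_half (y : rat) : 2 < `|y| -> `|y^-1| < 2^-1.
Proof. by move=> h; rewrite normfV ltf_pV2 // ?posrE; lra. Qed.

(** Expansions with terms of absolute value >= 3 are unique, and f finds them:
at each step, f and the given expansion both round the value to a nearest
integer, and bounds > 2 on the tail rule out ties. *)
Lemma f_of_large_cf s (q : int) t : scf_rec s -> all (fun q : int => 2 < `|q|) t ->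
  cf s = cf (q :: t) -> f s = q :: t.
Proof.
have [n] := ubnP (size s); elim: n s q t => // n IH s q t sn hs ht.
(* x is the value minus q, zero exactly when the expansion stops at q. *)
have [x [Ex hx hx0]] : exists x : rat, [/\ cf (q :: t) = Some (q%:~R + x), `|x| < 2^-1
    & if t is [::] then x = 0 else x != 0 /\ cf t = Some x^-1].
  case: t ht => [|p t] ht; first by exists 0; rewrite addr0 normr0.
  have [y Ey y2] := cf_gt2 _ _ ht.
  have y0 : y != 0 by rewrite -normr_gt0; lra.
  exists y^-1; rewrite cf_cons Ey (negbTE y0) invrK invr_eq0; split => //.
  exact: normV_lt_half.
rewrite Ex; case: s sn hs => [|p [|p' s]] // sn hs.
  move=> [E]; have [|||-> x0] := nearest_unique q p x 0; rewrite ?addr0 ?normr0 //.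
  by case: t hx0 {ht Ex} => // p' t []; rewrite x0 eqxx.
have [m [e [s' [y [[hs' s'n] -> Ey y2 ->]]]]] := f_nearest_step _ _ _ hs.
have y0 : (-1) ^+ e * y != 0 by rewrite mulf_eq0 signr_eq0 gt_eqF //; lra.
move=> [/esym E]; have [|qm xy] := nearest_unique _ _ _ _ E hx.
  by rewrite normfV normrM normr_sign mul1r ger0_norm ?lef_pV2 ?posrE; lra.
case: t ht hx0 {Ex} => [|t0 t] ht.
  by move=> x0; move: y0; rewrite -invr_eq0 -xy x0 eqxx.
move=> [_ Et]; rewrite qm; congr (_ :: _); rewrite -[RHS](signAK e); congr (signA e).
have Es : cf s' = cf (signA e (t0 :: t)).
  by rewrite cf_signA Et Ey /= xy invrK mulrA -expr2 sqrr_sign mul1r.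
have hst : all (fun q : int => 2 < `|q|) (signA e (t0 :: t)).
  case: (e) => //; rewrite /signA /oppA all_map.
  by apply: sub_all ht => z /=; rewrite normrN.
have [r [w Ew]] : exists r w, signA e (t0 :: t) = r :: w by case: (e); eexists; eexists.
rewrite Ew in Es hst *; apply: IH => //; first by move: sn s'n => /=; lia.
by case/andP: hst.
Qed.

(** * Divisibility along a sequence *)

(** Swapping the two moduli at each term, instead of testing the parity of an
index, lets proofs by induction on the sequence swap R and L likewise. *)
Fixpoint alternating (m n : int) (s : seq int) : bool :=
  if s is q :: s' then (m %| q)%Z && alternating n m s' else true.

Lemma divisibilityP (u v : int) s : divisibility_property u v s <-> alternating v u s.
Proof.
elim: s u v => [|q s IH] u v //=; split.
  move=> h; apply/andP; split; first exact: (h 0%N).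
  by apply/IH => i /(h i.+1) /=; case: (odd i).
by case/andP=> hq /IH h [|i] //= /h; case: (odd i).
Qed.

Lemma dvdz_small (m x : int) : `|x| < m -> (m %| x)%Z -> x = 0.
Proof. by move=> xm /dvdzP[k E]; case: (ltrgtP k 0) => k0; nia. Qed.

Lemma alternating_gt2 (m n : int) s : 3 <= m -> 3 <= n -> alternating m n s ->
  all (fun q : int => q != 0) s -> all (fun q : int => 2 < `|q|) s.
Proof.
elim: s m n => [|q s IH] m n //= m3 n3 /andP[mq hs] /andP[q0 s0].
rewrite (IH n m) // andbT ltNge; apply: contra q0 => q2.
by rewrite (dvdz_small m q) //; lia.
Qed.

(** * Matrices *)

Lemma mx2E (a b c d : int) :
  (mx2 a b c d 0 0 = a) * (mx2 a b c d 0 1 = b) *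
  (mx2 a b c d 1 0 = c) * (mx2 a b c d 1 1 = d).
Proof. by rewrite !mxE. Qed.

Lemma mulmx2E (M N : 'M[int]_2) i j : (M * N) i j = M i 0 * N 0 j + M i 1 * N 1 j.
Proof.
rewrite mxE !big_ord_recl big_ord0 addr0.
by congr (_ + M i _ * N _ j); apply: val_inj.
Qed.

Lemma mx2P (M N : 'M[int]_2) :
  M 0 0 = N 0 0 -> M 0 1 = N 0 1 -> M 1 0 = N 1 0 -> M 1 1 = N 1 1 -> M = N.
Proof.
have ord2 (i : 'I_2) : i = 0 \/ i = 1.
  by case: i => [[|[|i]] hi] //; [left|right]; apply: val_inj.
by move=> h00 h01 h10 h11; apply/matrixP => i j; case: (ord2 i) (ord2 j) => -> [] ->.
Qed.

Lemma det_mx2 (a b c d : int) : \det (mx2 a b c d) = a * d - b * c.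
Proof.
rewrite (expand_det_row _ 0) !big_ord_recl big_ord0 /cofactor !det_mx11 !mxE /=.
by rewrite expr0 expr1 mul1r mulN1r mulrN addr0.
Qed.

Lemma LmxD (x y : int) : Lmx (x + y) = Lmx x * Lmx y.
Proof. by apply: mx2P; rewrite mulmx2E /Lmx !mx2E; ring. Qed.

Lemma RmxD (x y : int) : Rmx (x + y) = Rmx x * Rmx y.
Proof. by apply: mx2P; rewrite mulmx2E /Rmx !mx2E; ring. Qed.

Lemma Lmx0 : Lmx 0 = 1.
Proof. by apply: mx2P; rewrite /Lmx !mx2E !mxE. Qed.

Lemma Rmx0 : Rmx 0 = 1.
Proof. by apply: mx2P; rewrite /Rmx !mx2E !mxE. Qed.

Lemma invr_unique (R : unitRingType) (x y : R) : x * y = 1 -> y * x = 1 -> x^-1 = y.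
Proof.
move=> xy yx; have ux : x \is a GRing.unit by apply/unitrP; exists y.
by apply: (mulrI ux); rewrite mulrV.
Qed.

Lemma LmxV x : (Lmx x)^-1 = Lmx (- x).
Proof. by apply: invr_unique; rewrite -LmxD ?subrr ?addNr Lmx0. Qed.

Lemma RmxV x : (Rmx x)^-1 = Rmx (- x).
Proof. by apply: invr_unique; rewrite -RmxD ?subrr ?addNr Rmx0. Qed.

(** Shared by the one-parameter subgroups L and R. *)
Lemma in_G_multiples (u v : int) (g : int -> 'M[int]_2) w :
  (forall x y, g (x + y) = g x * g y) -> g 0 = 1 -> (forall x, (g x)^-1 = g (- x)) ->
  in_G u v (g w) -> forall x, (w %| x)%Z -> in_G u v (g x).
Proof.
move=> gD g0 gV gw x /dvdzP[k ->].
have pos n : in_G u v (g (n%:Z * w)).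
  elim: n => [|n IH]; first by rewrite mul0r g0; apply: in_G_1.
  by rewrite intS mulrDl mul1r gD; apply: in_G_mul.
case: k => n; first exact: pos.
by rewrite NegzE mulNr -gV; apply/in_G_inv/pos.
Qed.

Lemma in_G_Lmx u v x : (u %| x)%Z -> in_G u v (Lmx x).
Proof. exact: (in_G_multiples u v Lmx u LmxD Lmx0 LmxV (in_G_L u v)). Qed.

Lemma in_G_Rmx u v x : (v %| x)%Z -> in_G u v (Rmx x).
Proof. exact: (in_G_multiples u v Rmx v RmxD Rmx0 RmxV (in_G_R u v)). Qed.

Lemma mx2_Rmx (q a b c d : int) : mx2 a b c d = Rmx q * mx2 (a - q * c) (b - q * d) c d.
Proof. by apply: mx2P; rewrite mulmx2E /Rmx !mx2E; ring. Qed.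

Lemma mx2_Lmx (q a b c d : int) : mx2 a b c d = Lmx q * mx2 a b (c - q * a) (d - q * b).
Proof. by apply: mx2P; rewrite mulmx2E /Lmx !mx2E; ring. Qed.

(** * From divisibility to membership *)

Lemma ratio_step (q m n : int) (y : rat) : y != 0 ->
  m%:~R = (q%:~R + y^-1) * n%:~R -> n%:~R = y * (m - q * n)%:~R.
Proof.
move=> y0 E; rewrite rmorphB rmorphM /= E; field.
exact: y0.
Qed.

(** Peeling terms off the expansion of the second column. The two alternatives
are the states before an R and before an L: they expand b/d with the moduli in
the order v, u, and d/b in the order u, v. The hypotheses on c and d survive
both kinds of step, since L-steps subtract multiples of u. *)
Lemma in_G_of_cf (u v : int) s x (a b c d : int) : 3 <= u -> cf s = Some x ->
  a * d - b * c = 1 -> (u %| c)%Z -> (u %| d - 1)%Z ->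
  (alternating v u s /\ b%:~R = x * d%:~R) \/
  (alternating u v s /\ d%:~R = x * b%:~R) ->
  in_G u v (mx2 a b c d).
Proof.
move=> u3; elim: s x a b c d => // q [|p s] IH x a b c d.
  move=> [<-] det uc ud [] [/=]; rewrite andbT => hq /eqP;
    rewrite -rmorphM eqr_int => /eqP E.
    have d1 : d = 1.
      (* Peeling the last term by an R leaves the column (0, d), so that d is a
         unit. *)
      have de : d * (a - q * c) = 1 by rewrite -det E; ring.
      have : absz (d * (a - q * c)) == 1%N by rewrite de.
      rewrite abszM muln_eq1 => /andP[/eqP d1 _].
      have [//|dN] : d = 1 \/ d = -1 by lia.
      by rewrite dN in ud; have := dvdz_small _ _ _ ud; lia.
    subst d; rewrite mulr1 in E; subst b.
    rewrite (mx2_Rmx q) mulr1 subrr; apply: in_G_mul; first exact: in_G_Rmx.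
    have -> : a - q * c = 1 by lia.
    exact: in_G_Lmx.
  (* The last term would be peeled by an L, but then u divides d. *)
  have u1 : (u %| 1%R)%Z.
    have -> : 1%R = q * b - (d - 1) :> int by rewrite -E; ring.
    by rewrite rpredB // dvdz_mulr.
  by have := dvdz_small _ _ _ u1; lia.
rewrite cf_cons; case Ey: (cf (p :: s)) => [y|//].
case: eqP => // /eqP y0 [<-] det uc ud [] [/andP[hq hs] E].
  rewrite (mx2_Rmx q); apply: in_G_mul; first exact: in_G_Rmx.
  apply: (IH y) => //; first by rewrite -det; ring.
  by right; split => //; apply: ratio_step.
rewrite (mx2_Lmx q); apply: in_G_mul; first exact: in_G_Lmx.
apply: (IH y) => //; first by rewrite -det; ring.
- by rewrite rpredB // dvdz_mulr.
- have -> : d - q * b - 1 = (d - 1) - q * b by ring.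
  by rewrite rpredB // dvdz_mulr.
by left; split => //; apply: ratio_step.
Qed.

(** * From membership to divisibility *)

(** The ratio condition is stated without division so that no condition on the
second entry of the column is needed. The length is odd because words act on
the ratio 0: an even length would expand the ratio of a first column. *)
Definition reduced_ratio (u v : int) (M : 'M[int]_2) : Prop :=
  exists s x, [/\ inA s, odd (size s), alternating v u s, cf s = Some x
    & (M 0 1)%:~R = x * (M 1 1)%:~R].

Lemma reduced_ratio1 u v : reduced_ratio u v 1.
Proof. by exists [:: 0], 0; split; rewrite //= ?dvdz0 // !mxE mul0r. Qed.

Lemma reduced_ratio_Rmx (u v w : int) M : (v %| w)%Z -> reduced_ratio u v M ->
  reduced_ratio u v (Rmx w * M).
Proof.
move=> vw [[|q s] [x []]] // As os /andP[hq hs] Ex E.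
exists (q + w :: s), (x + w%:~R); split => //.
- by rewrite /= rpredD.
- by rewrite (cf_head q _ _ x Ex) [q + w]addrC addrK.
by rewrite !mulmx2E /Rmx !mx2E !mul1r mul0r add0r rmorphD rmorphM /= E mulrDl.
Qed.

(** If the first term q is nonzero, the new expansion is 0, w, q, ...; if it is
0, then w merges with the second term p. When w + p = 0, both leading terms
cancel, as [0, 0, r, ...] = [r, ...]; the odd length guarantees that r exists.
That the new tails are defined and nonzero comes from their terms being of
absolute value at least 3. *)
Lemma reduced_ratio_Lmx (u v w : int) M : 3 <= u -> 3 <= v -> (u %| w)%Z ->
  reduced_ratio u v M -> reduced_ratio u v (Lmx w * M).
Proof.
move=> u3 v3 uw [[|q s] [x []]] // As os hqs Ex E.
have [->|w0] := eqVneq w 0; first by rewrite Lmx0 mul1r; exists (q :: s), x.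
have E01 : (Lmx w * M) 0 1 = M 0 1 by rewrite mulmx2E /Lmx !mx2E; ring.
have E11 : (Lmx w * M) 1 1 = w * M 0 1 + M 1 1 by rewrite mulmx2E /Lmx !mx2E; ring.
rewrite /reduced_ratio E01 E11 rmorphD rmorphM /=.
case/andP: (hqs) => hq hs; have s0 : all (fun q : int => q != 0) s by [].
have [q0|q0] := eqVneq q 0; last first.
  have big : all (fun q : int => 2 < `|q|) (w :: q :: s).
    by apply: (alternating_gt2 u v) => //=; rewrite ?uw ?w0 ?q0.
  have [y Ey y2] := cf_gt2 _ _ big; move: Ey; rewrite cf_cons Ex.
  case: eqP => // /eqP x0 [Ey].
  have y0 : y != 0 by rewrite -normr_gt0; lra.
  exists [:: 0, w, q & s], y^-1; split => //=.
  - by rewrite /inA /= w0 q0.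
  - by rewrite negbK.
  - by rewrite dvdz0 uw hq.
  - by rewrite [cf _]/= in Ex; rewrite Ex (negbTE x0) Ey (negbTE y0) add0r.
  have -> : (M 1 1)%:~R = x^-1 * (M 0 1)%:~R :> rat by rewrite E mulKf.
  by rewrite -mulrDl Ey mulrA mulVf // mul1r.
subst q; case: s As os hqs Ex hs s0 => [|p s] As os hqs.
  by move=> [x0] _ _; exists [:: 0], 0; split => //; rewrite E -x0 !mul0r.
rewrite cf_cons; case Ey: (cf (p :: s)) => [y|//].
case: eqP => // /eqP y0 [Ex] /andP[hp hs] /andP[p0 s0].
have E' : (M 1 1)%:~R = y * (M 0 1)%:~R :> rat.
  by rewrite E -Ex add0r mulrA mulfV // mul1r.
rewrite E' -mulrDl.
have Ey' := cf_head p (p + w) _ _ Ey; rewrite [p + w]addrC addrK in Ey'.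
have [pw0|pw0] := eqVneq (w + p) 0; last first.
  have big : all (fun q : int => 2 < `|q|) (w + p :: s).
    by apply: (alternating_gt2 u v) => //=; rewrite ?rpredD ?pw0.
  have [y' Ey'' y2] := cf_gt2 _ _ big; move: Ey''; rewrite Ey' => -[Eyw].
  have y'0 : y' != 0 by rewrite -normr_gt0; lra.
  exists [:: 0, w + p & s], y'^-1; split => //.
  - by rewrite /inA /= pw0.
  - by rewrite /= dvdz0 rpredD.
  - by rewrite cf_cons Ey' Eyw (negbTE y'0) add0r.
  - by rewrite addrC Eyw mulrA mulVf // mul1r.
case: s As os hqs Ey Ey' hs s0 => // r s As os hqs.
rewrite !cf_cons; case Ez: (cf (r :: s)) => [z|//].
case: eqP => // /eqP z0 [Ey] [Ey'] hs /andP[r0 s0].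
exists (r :: s), z; split => //.
  by move: os => /=; rewrite negbK.
by rewrite [w%:~R + y]addrC -Ey' pw0 add0r mulrA mulfV // mul1r.
Qed.

Lemma in_G_unit u v M : in_G u v M -> M \is a GRing.unit.
Proof.
elim=> {M} [||| M N _ hM _ hN | M _ hM]; rewrite ?unitrV ?unitr1 ?unitrMl //.
- by apply/unitrP; exists (Lmx (- u)); rewrite -!LmxD addNr subrr Lmx0.
- by apply/unitrP; exists (Rmx (- v)); rewrite -!RmxD addNr subrr Rmx0.
Qed.

(** Products and inverses require the statement for left multiplication of any
admissible N by M and by M^-1, rather than for M alone. *)
Lemma in_G_reduced_ratio (u v : int) M : 3 <= u -> 3 <= v -> in_G u v M ->
  reduced_ratio u v M.
Proof.
move=> u3 v3 hM.
suff H : forall N, reduced_ratio u v N ->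
    reduced_ratio u v (M * N) /\ reduced_ratio u v (M^-1 * N).
  by have [] := H 1 (reduced_ratio1 u v); rewrite mulr1.
elim: hM => {M} [N hN|N hN|N hN|M M' hM IHM hM' IHM' N hN|M hM IH N hN].
- by rewrite LmxV; split; apply: reduced_ratio_Lmx; rewrite // ?rpredN.
- by rewrite RmxV; split; apply: reduced_ratio_Rmx; rewrite // ?rpredN.
- by rewrite invr1 mul1r.
- rewrite invrM; [|exact: in_G_unit hM|exact: in_G_unit hM'].
  rewrite -!mulrA; split; first by apply: proj1 (IHM _ _); apply: proj1 (IHM' _ _).
  by apply: proj2 (IHM' _ _); apply: proj2 (IHM _ _).
- by rewrite invrK; have [] := IH N hN.
Qed.

Theorem theorem6 (u v : int) (hu : 3 <= u) (hv : 3 <= v) (a b c d : int)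
    (hM : in_scrG u v (mx2 a b c d)) :
  in_G u v (mx2 a b c d) <->
  divisibility_property u v (f (C (b%:~R / d%:~R))).
Proof.
case: hM => det [n1 [n2 [n3 [n4 EM]]]].
have ec : c = u * n3 by have := congr1 (fun M : 'M_2 => M 1 0) EM; rewrite !mx2E.
have ed : d = 1 + u * v * n4.
  by have := congr1 (fun M : 'M_2 => M 1 1) EM; rewrite !mx2E.
have ud : (u %| d - 1)%Z by rewrite ed addrC addKr -mulrA dvdz_mulr.
have d0 : d%:~R != 0 :> rat.
  rewrite intr_eq0; apply/eqP => d0; rewrite d0 in ud.
  by have := dvdz_small _ _ _ ud; lia.
have [A1 Ecf] := CP (b%:~R / d%:~R); rewrite inA1E in A1.
rewrite divisibilityP; split.
  move=> /(in_G_reduced_ratio _ _ _ hu hv) [[|q s] [x []]] // As _ hs Ex.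
  rewrite !mx2E => E; have Exbd : x = b%:~R / d%:~R by rewrite E mulfK.
  rewrite (f_of_large_cf _ q s) //; last by rewrite Ecf Ex Exbd.
  by case/andP: hs => _ hs; apply: (alternating_gt2 u v).
move=> hs; apply: (in_G_of_cf u v (f (C (b%:~R / d%:~R)))) => //.
- by rewrite cf_f // Ecf.
- by rewrite -det_mx2.
- by rewrite ec dvdz_mulr.
- by left; split => //; rewrite divfK.
Qed.
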